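(* Let $K$ be a compact Hausdorff space satisfying at least one of the following conditions: (1) there exists a closed subset $\Omega$ of $K$ having uncountably many relatively clopen subsets (in particular, this is the case if $K$ has a closed subset $\Omega$ that is non-metrizable and totally disconnected); (2) $K$ is not hereditarily Lindelöf; (3) $K$ is not hereditarily separable; (4) $|K|>2^{\omega}$ (the cardinality of the continuum); (5) $K$ admits a Radon probability measure of uncountable type. Then $K$ admits an uncountable linked family of closed pairs (and hence the closed unit ball of $C(K)$ contains an uncountable $2$-equilateral set).
   Context: $C(K)$ is the Banach space of continuous real functions on $K$ with the supremum norm. A subset $S$ of a metric space $(M,d)$ is $\lambda$-equilateral ($\lambda>0$) if $d(x,y)=\lambda$ for all distinct $x,y\in S$. A family $\{(A_i,B_i): i\in I\}$ of pairs of subsets of a nonempty set $\Gamma$ is called linked if (i) $A_i\cap B_i=\emptyset$ for all $i\in I$; (ii) $A_i\cup B_i\neq\emptyset$ for all $i\in I$; (iii) for all $i\neq j$ in $I$, either $A_i\cap B_j\neq\emptyset$ or $A_j\cap B_i\neq\emptyset$. A linked family of closed pairs in a topological space is a linked family with all $A_i,B_i$ closed; it is uncountable if $I$ is. A topological space is hereditarily Lindelöf (respectively hereditarily separable) if every subspace is Lindelöf (respectively separable). A Radon probability measure $\mu$ on $K$ is of uncountable type if $\dim L_1(\mu)\ge\omega_1$, where $\dim$ denotes the density character, i.e. if the Banach space $L_1(\mu)$ is non-separable. *)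

(* Defs.v *)
From HB Require Import structures.
From mathcomp Require Import all_boot all_order all_algebra.
From mathcomp Require Import all_classical all_reals all_analysis.
Set Implicit Arguments.
Unset Strict Implicit.
Unset Printing Implicit Defensive.
Import Order.TTheory GRing.Theory Num.Theory.
Import numFieldNormedType.Exports.
Local Open Scope classical_set_scope.
Local Open Scope ring_scope.

Definition linked (Gamma I : Type) (A B : I -> set Gamma) : Prop :=
  [/\ forall i, A i `&` B i = set0,
      forall i, A i `|` B i !=set0 &
      forall i j, i <> j -> A i `&` B j !=set0 \/ A j `&` B i !=set0].

Definition has_uncountable_linked_closed (K : topologicalType) : Prop :=
  exists (I : Type) (A B : I -> set K),
    [/\ ~ countable [set: I], linked A B &
        forall i, closed (A i) /\ closed (B i)].

Definition lindelof (T : topologicalType) : Prop :=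
  forall C : set (set T), (forall U, C U -> open U) ->
    \bigcup_(U in C) U = [set: T] ->
    exists D : set (set T),
      [/\ D `<=` C, countable D & \bigcup_(U in D) U = [set: T]].

Definition separable (T : topologicalType) : Prop :=
  exists2 D : set T, countable D & dense D.

(* The subtype [set_type A] carries the topology induced from [T]. *)
Definition hereditarily (P : topologicalType -> Prop) (T : topologicalType) :
  Prop := forall A : set T, P (set_type A).

Definition metrizable (R : realType) (T : topologicalType) : Prop :=
  exists d : T -> T -> R,
    [/\ forall x y, d x y = 0 <-> x = y,
        forall x y, d x y = d y x,
        forall x y z, d x z <= d x y + d y z &
        forall U : set T, open U <->
          (forall x, U x -> exists2 e, 0 < e & [set y | d x y < e] `<=` U)].

(* Measurable types are pointed, topological spaces need not be: the base
   point [x0] only serves to equip [K] with its Borel sigma-algebra, which does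
   not depend on it. *)
Definition pointed_at (K : Type) (x0 : K) : Type := K.
HB.instance Definition _ (K : choiceType) (x0 : K) :=
  Choice.copy (pointed_at x0) K.
HB.instance Definition _ (K : choiceType) (x0 : K) :=
  isPointed.Build (pointed_at x0) x0.

Notation borel x0 :=
  (g_sigma_algebraType (@open _ : set (set (pointed_at x0)))).

Definition radon (R : realType) (K : topologicalType) (x0 : K)
    (mu : probability (borel x0) R) : Prop :=
  forall A : set (borel x0), measurable A ->
    mu A = ereal_sup [set mu C | C in [set C : set K | compact C /\ C `<=` A]].

Definition L1_separable (R : realType) (d : measure_display)
    (T : measurableType d) (mu : {measure set T -> \bar R}) : Prop :=
  exists2 D : set (LspaceType1 mu), countable D &
    forall (f : LspaceType1 mu) (e : R), 0 < e ->
      exists2 g, D g &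
        ('N[mu]_1[EFin \o ((f : T -> R) \- (g : T -> R))%R] < e%:E)%E.

Definition has_radon_uncountable_type (R : realType) (K : topologicalType) :
  Prop := exists (x0 : K) (mu : probability (borel x0) R),
    radon mu /\ ~ L1_separable mu.

Definition equilateral (R : realType) (M : Type) (d : M -> M -> R)
    (lambda : R) (S : set M) : Prop :=
  forall x y, S x -> S y -> x <> y -> d x y = lambda.

(* [sup] is only meaningful on bounded sets (it is 0 otherwise): the supremum
   norm is used on continuous functions on compact spaces. It is 0 when [K] is
   empty. *)
Definition sup_norm (R : realType) (K : Type) (f : K -> R) : R :=
  sup [set `|f x| | x in [set: K]].

Definition sup_dist (R : realType) (K : topologicalType)
  (f g : continuousType K R) : R := sup_norm (f \- g).

Definition unit_ball (R : realType) (K : topologicalType) :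
  set (continuousType K R) := [set f | sup_norm f <= 1].
Arguments unit_ball : clear implicits.

(* Main.v *)
(* In each case the pairs come from an uncountable "separated" family.
   (1): a clopen set and its complement.
   (2), (3): a point x_a, and either the complement of an open neighbourhood of
   x_a missing all the later points, or the closure of the earlier points.
   (4): a hereditarily Lindelof separable Hausdorff space K with countable dense
   D is small: each x is the only point of the intersection of the closures of
   countably many open sets U_n containing x, so it is determined by the sets
   U_n `&` D.
   (5): if L_1(mu) is not separable, uncountably many measurable sets E_i are
   pairwise at distance at least e for the measure of the symmetric difference;
   take closed sets A_i in E_i and B_i in ~` E_i, each missing less than e / 4
   of the mass.
   Urysohn functions that are -1 on A_i and 1 on B_i are 2-equilateral. *)

Require Import Defs.
From mathcomp Require Import all_boot all_order all_algebra.
From mathcomp Require Import all_classical all_reals all_analysis.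
From mathcomp Require Import wochoice measurable_realfun ring lra.
Import Order.TTheory GRing.Theory Num.Theory.
Import numFieldNormedType.Exports.
Local Open Scope classical_set_scope.
Local Open Scope card_scope.
Local Open Scope ring_scope.

Set Implicit Arguments.
Unset Strict Implicit.
Unset Printing Implicit Defensive.

(** * Well-orders, maximal separated sets, countability and linked families *)

(** [lt] is the strict part of a reflexive well-order; the two properties kept are those that let
    one speak of least elements and of earlier and later points. *)
Lemma exists_well_order (T : Type) : exists lt : T -> T -> Prop,
  (forall x y, x <> y -> lt x y \/ lt y x) /\
  (forall P : set T, P !=set0 ->
     exists2 x, P x & forall y, P y -> ~ lt y x).
Proof.
have [r wor] := well_ordering_principle {classic T}.
exists (fun x y => x <> y /\ r x y); split=> [x y xy|P [p Pp]].
  have [] := wor (fun z => (z == x) || (z == y)).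
    by exists x; apply/orP; left; exact/eqP.
  move=> z [[zxy lz] _]; case/orP: zxy => /eqP zE; move: lz; rewrite zE => lz.
    by left; split=> //; apply: lz; apply/orP; right; exact/eqP.
  by right; split; [exact/nesym|apply: lz; apply/orP; left; exact/eqP].
have [] := wor (fun z => `[< P z >]).
  by exists p; exact/asboolP.
move=> x [[/asboolP Px lx] ux]; exists x => // y Py [yx ryx].
have rxy : r x y by apply: lx; exact/asboolP.
(* Antisymmetry: [x] and [y] are both minima of the pair they form, and the minimum is unique. *)
have [|z [[zxy lz] uz]] := wor (fun z => (z == x) || (z == y)).
  by exists x; apply/orP; left; exact/eqP.
have rxx : r x x by apply: lx; exact/asboolP.
have ryy : r y y.
  have [|w [[/eqP -> lw] _]] := wor (fun z => z == y).
    by exists y; apply/eqP.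
  by apply: lw; apply/eqP.
have zx : z = x.
  apply: uz; split; first by apply/orP; left; exact/eqP.
  by move=> w /orP[]/eqP ->.
have zy : z = y.
  apply: uz; split; first by apply/orP; right; exact/eqP.
  by move=> w /orP[]/eqP ->.
by apply: yx; rewrite -zx -zy.
Qed.

(** Zorn's lemma, with [r] read as nearness: a point of [S] near no point of a maximal [Y] could be
    added to it. *)
Lemma maximal_separated (T : Type) (S : set T) (r : T -> T -> Prop) :
  (forall x, r x x) -> (forall x y, r x y -> r y x) ->
  exists Y : set T, [/\ Y `<=` S,
    forall x y, Y x -> Y y -> x <> y -> ~ r x y &
    forall x, S x -> exists2 y, Y y & r x y].
Proof.
move=> rr rC.
pose P (Y : set T) :=
  Y `<=` S /\ forall x y, Y x -> Y y -> x <> y -> ~ r x y.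
have [F FP Ftot|Y [[YS Ysep] Ymax]] := @Zorn_bigcup T P.
  split=> [x [X FX Xx]|x y [X FX Xx] [Z FZ Zy]]; first exact: (FP _ FX).1.
  have [XZ|ZX] := Ftot _ _ FX FZ.
    by apply: (FP _ FZ).2 => //; exact: XZ.
  by apply: (FP _ FX).2 => //; exact: ZX.
exists Y; split=> // x Sx; apply: contrapT => nex.
apply: (Ymax (Y `|` [set x])).
  split; last by move=> /(_ x (or_intror erefl)) Yx; apply: nex; exists x.
  by move=> z Yz; left.
split=> [z [/YS//|->//]|y z [Yy|->] [Yz|->]] //; first exact: Ysep.
- by move=> _ ryx; apply: nex; exists y => //; exact: rC.
- by move=> _ rxz; apply: nex; exists z.
Qed.

Lemma countable_image (T U : Type) (f : T -> U) (A : set T) :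
  countable A -> countable (f @` A).
Proof. exact/sub_countable/card_image_le. Qed.

Lemma countable_subset (T : Type) (A B : set T) :
  A `<=` B -> countable B -> countable A.
Proof. by move=> AB; exact/sub_countable/subset_card_le. Qed.

(** When [A] is empty, [f] is constantly [a]. *)
Lemma countable_enum (T : Type) (A : set T) (a : T) :
  countable A -> exists f : nat -> T, A `<=` range f.
Proof.
move=> /pfcard_geP[->|[f]]; first by exists (fun=> a).
by exists f => x Ax; have [n _ <-] := 'surj_f Ax; exists n.
Qed.

(* Nonemptiness of [A y `|` B y] is not required: it follows from the linking
   condition as soon as [Y] has two elements. *)
Lemma linked_of_uncountable (J : Type) (K : topologicalType) (Y : set J)
    (A B : J -> set K) :
  ~ countable Y ->
  (forall y, Y y -> [/\ closed (A y), closed (B y) & A y `&` B y = set0]) ->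
  (forall y z, Y y -> Y z -> y <> z ->
     A y `&` B z !=set0 \/ A z `&` B y !=set0) ->
  has_uncountable_linked_closed K.
Proof.
move=> Yunc Ycl Ylink.
exists (set_type Y), (fun i => A (set_val i)), (fun i => B (set_val i)).
have Yi (i : set_type Y) : Y (set_val i) by rewrite set_valE; exact: set_valP.
split; [|split|].
- move=> cY; apply: Yunc.
  apply: (countable_subset _ (countable_image set_val cY)).
  by move=> y Yy; exists (exist _ y (mem_set Yy)).
- by move=> i; have [] := Ycl _ (Yi i).
- move=> i; have [y [Yy yi]] : exists y, Y y /\ set_val i <> y.
    apply: contrapT => nex; apply: Yunc.
    apply: (countable_subset _ (countable1 (set_val i))) => y Yy.
    by apply: contrapT => yi; apply: nex; exists y; split => //; exact/nesym.
  have [[x [Ax _]]|[x [_ Bx]]] := Ylink _ _ (Yi i) Yy yi.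
    by exists x; left.
  by exists x; right.
- move=> i j ij; apply: Ylink => // /val_inj; exact: ij.
- by move=> i; have [] := Ycl _ (Yi i).
Qed.

(** * Linked families from clopen sets, open covers and dense sets *)

Lemma hausdorff_closed_set1 (K : topologicalType) (x : K) :
  hausdorff_space K -> closed [set x].
Proof.
by move=> hK; apply: accessible_closed_set1; exact: hausdorff_accessible.
Qed.

Lemma closed_image_subtype (K : topologicalType) (Omega : set K)
    (C : set (set_type Omega)) :
  closed Omega -> closed C -> closed (set_val @` C).
Proof.
move=> clO /closed_openC[W oW WC].
have -> : set_val @` C = Omega `&` ~` W.
  apply/seteqP; split=> [_ [x Cx <-]|x [Ox nWx]].
    split; first by rewrite set_valE; exact: set_valP.
    by move=> Wx; have : (set_val @^-1` W) x by []; rewrite WC; exact.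
  exists (exist _ x (mem_set Ox)) => //; apply: contrapT => nC.
  by have : (~` C) (exist _ x (mem_set Ox)) by []; rewrite -WC.
by apply: closedI => //; exact: open_closedC.
Qed.

(** Distinct clopen sets differ at a point, which lies in one of them and in the complement of the
    other. *)
Lemma linked_of_clopen (K : topologicalType) (Omega : set K) :
  closed Omega -> ~ countable (@clopen (set_type Omega)) ->
  has_uncountable_linked_closed K.
Proof.
move=> clO unc.
apply: (@linked_of_uncountable _ K (@clopen (set_type Omega))
  (fun C => set_val @` C) (fun C => set_val @` (~` C))) => //.
- move=> C [oC cC]; split.
  + exact: closed_image_subtype.
  + by apply: closed_image_subtype => //; exact: open_closedC.
  + rewrite -subset0 => _ [[x Cx <-] [y nCy]] /val_inj yx.
    by apply: nCy; rewrite yx.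
- move=> C D _ _ CD; apply: contrapT => /not_orP[nCD nDC]; apply: CD.
  apply/seteqP; split=> x.
    move=> Cx; apply: contrapT => nDx; apply: nCD; exists (set_val x).
    by split; exists x.
  move=> Dx; apply: contrapT => nCx; apply: nDC; exists (set_val x).
  by split; exists x.
Qed.

(** Well-order the open sets and let [r x] be the least member of the cover [C] containing [x]. If
    [r a] precedes [r b], then [b] is not in [r a], by minimality of [r b]. *)
Lemma linked_of_not_lindelof (K : topologicalType) :
  hausdorff_space K -> ~ hereditarily lindelof K ->
  has_uncountable_linked_closed K.
Proof.
move=> hK /existsNP[X /existsNP[C /not_implyP[Copen /not_implyP[Ccov nC]]]].
have [lt [lt_total lt_least]] := exists_well_order (set (set_type X)).
have /choice[r rP] (x : set_type X) : exists U,
    [/\ C U, U x & forall V, C V -> V x -> ~ lt V U].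
  have [|U [CU Ux] Umin] := lt_least [set U | C U /\ U x].
    have : [set: set_type X] x by [].
    by rewrite -Ccov => -[U CU Ux]; exists U.
  by exists U; split=> // V CV Vx; exact: Umin.
(* [Y] selects one point for each value of [r], so [r] sends it onto a subcover; hence it is
   uncountable. *)
have [//|x y -> //|Y [_ Ysep Ymax]] :=
  @maximal_separated _ [set: set_type X] (fun x y => r x = r y).
have /choice[W WP] (x : set_type X) : exists W, open W /\ set_val @^-1` W = r x.
  by have [/Copen[W oW WE] _ _] := rP x; exists W.
apply: (@linked_of_uncountable _ K Y (fun y => [set set_val y])
  (fun y => ~` W y)).
- move=> cY; apply: nC; exists (r @` Y); split.
  + by move=> _ [x _ <-]; have [] := rP x.
  + exact: countable_image.
  + apply/seteqP; split=> // x _; have [y Yy rxy] := Ymax x I.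
    by exists (r y); [exists y|rewrite -rxy; have [] := rP x].
- move=> y Yy; have [oW WE] := WP y; split.
  + exact: hausdorff_closed_set1.
  + exact: open_closedC.
  + rewrite -subset0 => _ [->]; apply; have [_ + _] := rP y.
    by rewrite -WE.
- move=> y z Yy Yz yz.
  have key a b : lt (r a) (r b) -> [set set_val b] `&` ~` W a !=set0.
    move=> ab; exists (set_val b); split=> // Wb.
    have [Ca _ _] := rP a; have [_ _ /(_ _ Ca) minb] := rP b.
    by apply: minb => //; have [_ <-] := WP a.
  by have [|/key|/key] := lt_total (r y) (r z); [exact: Ysep|right|left].
Qed.

(** Well-order [X] and keep the points outside the closure of their predecessors. The least point of
    any nonempty open set is kept, so the kept points are dense in [X], hence uncountable. *)
Lemma linked_of_not_separable (K : topologicalType) :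
  hausdorff_space K -> ~ hereditarily separable K ->
  has_uncountable_linked_closed K.
Proof.
move=> hK /existsNP[X nsep].
have [lt [lt_total lt_least]] := exists_well_order (set_type X).
pose pre x := closure (set_val @` [set y : set_type X | lt y x]).
apply: (@linked_of_uncountable _ K [set x | ~ pre x (set_val x)]
  (fun y => [set set_val y]) pre).
- move=> cY; apply: nsep.
  exists [set x : set_type X | ~ pre x (set_val x)] => // U U0 oU.
  have [x Ux xmin] := lt_least U U0; exists x; split=> //= prex.
  case: oU => W oW WU.
  have [|_ [[y ltyx <-] Wy]] := prex W.
    by apply: open_nbhs_nbhs; split=> //; move: Ux; rewrite -WU.
  by apply: (xmin y) => //; rewrite -WU.
- move=> y /= npre; split.
  + exact: hausdorff_closed_set1.
  + exact: closed_closure.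
  + by rewrite -subset0 => _ [->].
- move=> y z _ _ yz.
  have key a b : lt a b -> [set set_val a] `&` pre b !=set0.
    move=> ab; exists (set_val a); split=> //; apply: subset_closure.
    by exists a.
  by have [/key|/key] := lt_total _ _ yz; [left|right].
Qed.

(** * Cardinality of hereditarily Lindelöf separable spaces *)

(** Open sets [V] whose closure misses [x] cover the complement of [x]. For [V] in a countable
    subcover, the complement of [closure V] is an open neighbourhood of [x] whose closure misses
    [V]. *)
Lemma lindelof_pseudocharacter (K : topologicalType) (x : K) :
  hausdorff_space K -> lindelof (set_type (~` [set x])) ->
  exists U : nat -> set K, (forall n, open (U n) /\ U n x) /\
    forall y, y <> x -> exists n, ~ closure (U n) y.
Proof.
move=> hK lin.
pose C := [set V : set K | open V /\ ~ closure V x].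
have sepx y : y <> x -> exists2 V, C V & V y.
  move=> /eqP; have := hK; rewrite open_hausdorff => /[apply] -[[V W]/=].
  rewrite !inE => -[Vy Wx] [oV oW /eqP VW].
  exists V => //; split=> // /(_ W (open_nbhs_nbhs (conj oW Wx))).
  by move=> [z [Vz Wz]]; move: VW => /eqP VW; rewrite -[False]/(set0 z) -VW.
pose restr (V : set K) : set (set_type (~` [set x])) := set_val @^-1` V.
have [|/=|D [DC cD Dcov]] := lin (restr @` C).
- by move=> _ [V [oV _] <-]; exists V.
- apply/seteqP; split=> // y _.
  have yx : set_val y <> x by exact: (set_valP y).
  by have [V CV Vy] := sepx _ yx; exists (restr V) => //; exists V.
(* [w] lifts members of [D] to open sets of [K]; outside [D], [set0] still satisfies the first two
   requirements, so every term of an enumeration can be used. *)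
have /choice[w wP] (d : set (set_type (~` [set x]))) : exists V,
    (~ closure V x /\ open V) /\ (D d -> restr V = d).
  have [/DC[V [oV nV] VE]|nD] := pselect (D d); first by exists V.
  exists set0; split=> //; split; last exact: open0.
  by rewrite closure0.
have [f Df] := countable_enum set0 cD.
exists (fun n => ~` closure (w (f n))); split=> [n|y yx].
  by split; [exact/closed_openC/closed_closure|have [[]] := wP (f n)].
have [d Dd dy] : (\bigcup_(U in D) U) (exist _ y (mem_set yx)).
  by rewrite Dcov.
have [n _ fn] := Df _ Dd; exists n.
have [[nwx ow] wd] := wP (f n).
move=> /(_ (w (f n)))[|z [nz wz]].
  apply: open_nbhs_nbhs; split=> //.
  have Df' : D (f n) by rewrite fn.
 by have : restr (w (f n)) (exist _ y (mem_set yx)) by rewrite (wd Df') fn.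
by apply: nz; exact: subset_closure.
Qed.

(** [f x] codes the traces of the sets [U x n] on [D]. If [f x = f y], then by density every
    neighbourhood of [y] meets [U y n] in a point of [D], which is also in [U x n]; so [y] is in the
    closure of every [U x n], and [y = x]. *)
Lemma card_le_continuum (K : topologicalType) :
  hausdorff_space K -> hereditarily lindelof K -> separable K ->
  [set: K] #<= [set: nat -> bool].
Proof.
move=> hK hL [D cD dD].
have /choice[U UP] (x : K) := lindelof_pseudocharacter hK (hL (~` [set x])).
have /countable_injP[e einj] := cD.
pose f (x : K) (k : nat) : bool :=
  `[< exists n p, [/\ k = pickle (n, e p), D p & U x n p] >].
have fE x y : f x = f y -> forall n p, D p -> U x n p -> U y n p.
  move=> fxy n p Dp Up.
  have : f x (pickle (n, e p)) by apply/asboolP; exists n, p.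
  rewrite fxy => /asboolP[m [q [/(pcan_inj pickleK)[-> epq] Dq Uq]]].
  by rewrite (einj p q) ?inE.
apply/pcard_injP; exists f => x y _ _ fxy; apply: contrapT => /nesym yx.
have [_ /(_ _ yx)[n]] := UP x; apply=> W; rewrite nbhsE => -[V [oV Vy] VW].
have [oU Uy] := (UP y).1 n.
have [|d [[Vd Ud] Dd]] := dD (V `&` U y n) _ (openI oV oU); first by exists y.
by exists d; split; [exact: fE (esym fxy) _ _ Dd Ud|exact: VW].
Qed.

(** Without a linked family, [K] is hereditarily Lindelöf and hereditarily separable by the previous
    cases, hence no larger than the continuum. *)
Lemma linked_of_large (K : topologicalType) :
  hausdorff_space K ->
  [set: nat -> bool] #<= [set: K] -> [set: K] #!= [set: nat -> bool] ->
  has_uncountable_linked_closed K.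
Proof.
move=> hK leK /negP neK; apply: contrapT => nlink; apply: neK.
rewrite card_eq_le leK andbT; apply: card_le_continuum => //.
  by apply: contrapT => /(linked_of_not_lindelof hK).
have : hereditarily separable K.
  by apply: contrapT => /(linked_of_not_separable hK).
move=> /(_ setT)[D cD dD]; exists (set_val @` D); first exact: countable_image.
move=> V [x Vx] oV.
have [||d [Vd Dd]] := dD (set_val @^-1` V).
- by exists (exist _ x (mem_set I)).
- by exists V.
- by exists (set_val d); split=> //; exists d.
Qed.

(** * From linked families to equilateral sets *)

Lemma equilateral_of_linked (R : realType) (K : topologicalType) :
  compact [set: K] -> hausdorff_space K -> has_uncountable_linked_closed K ->
  exists S : set (continuousType K R),
    [/\ S `<=` unit_ball R K, equilateral (@sup_dist R K) 2 S &
        ~ countable S].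
Proof.
move=> cK hK [I [A [B [uncI [AB0 _ link] cl]]]].
have nK := compact_normal hK cK.
have /choice[f fP] (i : I) : exists f : continuousType K R,
    [/\ forall x, `|f x| <= 1, forall x, A i x -> f x = -1 &
        forall x, B i x -> f x = 1].
  have [clA clB] := cl i.
  have /(@uniform_separatorP _ R)[g [cg g01 gA gB]] :=
    (@normal_separatorP R K).1 nK _ _ clA clB (AB0 i).
  (* Rescales the Urysohn function from values in [0, 1] to values in [-1, 1]. *)
  have ch : continuous (fun x => 2 * g x - 1).
    move=> x; apply: cvgB; last exact: cvg_cst.
    by apply: cvgM; [exact: cvg_cst|exact: cg].
  have hE x : (mkcts ch : continuousType K R) x = 2 * g x - 1 by [].
  exists (mkcts ch); split=> x; rewrite hE.
  - have := g01 (g x) (imageT g x).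
    rewrite /= in_itv/= ler_norml => /andP[? ?]; by apply/andP; split; lra.
  - by move=> Ax; rewrite (_ : g x = 0); [lra|apply: gA; exists x].
  - by move=> Bx; rewrite (_ : g x = 1); [lra|apply: gB; exists x].
have dist2 i j : i <> j -> sup_dist (f i) (f j) = 2.
  move=> ij; have [fi fiA fiB] := fP i; have [fj fjA fjB] := fP j.
  have [x fx] : exists x, `|f i x - f j x| = 2.
    have [[x [Ax Bx]]|[x [Ax Bx]]] := link i j ij; exists x.
      by rewrite fiA// fjB// -opprD normrN ger0_norm//; lra.
    by rewrite fiB// fjA// opprK ger0_norm//; lra.
  have ub2 y : `|f i y - f j y| <= 2.
    by rewrite (le_trans (ler_normB _ _))// (le_trans (lerD (fi y) (fj y))).
  apply/eqP; rewrite eq_le; apply/andP; split.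
    by apply: ge_sup => [|_ [y _ <-]]; [exists `|f i x - f j x|, x|exact: ub2].
  rewrite -[leLHS]fx; apply: ub_le_sup; last by exists x.
  by exists 2 => _ [y _ <-]; exact: ub2.
exists (range f); split.
- move=> _ [i _ <-]; have [fi _ _] := fP i; rewrite /unit_ball/= /sup_norm.
  have [[x Kx]|/nonemptyPn K0] := pselect ([set: K] !=set0).
    by apply: ge_sup => [|_ [y _ <-]]; [exists `|f i x|, x|exact: fi].
  by rewrite K0 image_set0 sup0.
- move=> _ _ [i _ <-] [j _ <-] fij; apply: dist2.
  by move=> ij; apply: fij; rewrite ij.
(* [f] is injective, since functions with distinct indices are at distance 2 and not 0; so a
   countable range would make [I] countable. *)
- move=> /countable_injP[e einj]; apply: uncI.
  apply/countable_injP; exists (e \o f) => i j _ _ /= eij.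
  apply: contrapT => ij; have := dist2 _ _ ij.
  rewrite (einj (f i) (f j)) ?inE//=; [|by exists i|by exists j].
  rewrite /sup_dist /sup_norm.
  have [x] : [set: K] !=set0 by have [[x _]|[x _]] := link _ _ ij; exists x.
  move=> _; rewrite (_ : [set _ | _ in _] = [set 0]) ?sup1; first by lra.
  apply/seteqP; split=> [_ [y _ <-]|_ ->]; first by rewrite /= subrr normr0.
  by exists x => //; rewrite /= subrr normr0.
Qed.

(** * Compact totally disconnected spaces *)

Lemma compact_subtype (K : topologicalType) (X : set K) :
  compact X -> compact [set: set_type X].
Proof.
move=> cX F FF _.
have FX : F (set_val @^-1` X).
  by apply: (filterS _ filterT) => x _; exact: (set_valP x).
have [p [Xp clp]] := cX (set_val @ F) _ FX.
exists (exist _ p (mem_set Xp)); split=> // B C FB [_ [[W oW <-] Wp] WC].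
have FB' : F (set_val @^-1` (set_val @` B)).
  by apply: filterS FB => b Bb; exists b.
have [_ [[b Bb <-] Wb]] := clp _ _ FB' (open_nbhs_nbhs (conj oW Wp)).
by exists b; split=> //; exact: WC.
Qed.

Lemma hausdorff_subtype (K : topologicalType) (X : set K) :
  hausdorff_space K -> hausdorff_space (set_type X).
Proof.
move=> hK x y clxy; apply: val_inj; apply: hK => A B Ax By.
have [z [Az Bz]] := clxy _ _ (initial_continuous Ax) (initial_continuous By).
by exists (set_val z).
Qed.

Lemma totally_disconnected_subtype (K : topologicalType) (X : set K) :
  totally_disconnected X -> totally_disconnected [set: set_type X].
Proof.
move=> dX x _; apply/seteqP; split=> [y|_ ->]; last first.
  exact: connected_component_refl.
move=> [C [Cx _ Cconn] Cy].
have : connected_component X (set_val x) (set_val y).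
  exists (set_val @` C); last by exists y.
  split; first by exists x.
    by move=> _ [z _ <-]; rewrite set_valE; exact: set_valP.
  apply: connected_continuous_connected => //.
  by apply: continuous_subspaceT; exact: initial_continuous.
by rewrite dX; [move=> /val_inj|rewrite set_valE; exact: set_valP].
Qed.

(** Otherwise the sets [D] minus [W], for [D] clopen around [x], generate a proper filter. Its
    cluster point lies in every such [D], hence in the open set [W], which misses a member of the
    filter. *)
Lemma compact_clopen_sub (T : topologicalType) (x : T) (W : set T) :
  compact [set: T] -> open W ->
  (forall y, (forall D, clopen D -> D x -> D y) -> W y) ->
  exists D, [/\ clopen D, D x & D `<=` W].
Proof.
move=> cT oW QW; apply: contrapT => nex.
pose F := filter_from [set D : set T | clopen D /\ D x] (fun D => D `&` ~` W).
have FF : ProperFilter F.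
  apply: filter_from_proper.
    apply: filter_from_filter; first by exists setT; split=> //; exact: clopenT.
    move=> D E [cD Dx] [cE Ex]; exists (D `&` E).
      by split; [exact: clopenI|].
    by move=> z [[Dz Ez] nWz].
  move=> D [cD Dx]; apply: contrapT => nD; apply: nex.
  exists D; split=> // z Dz.
  by apply: contrapT => nWz; apply: nD; exists z.
have [z [_ clz]] := cT F FF (filterT).
have Wz : W z.
  apply: QW => D [oD cD] Dx; rewrite (closure_id D).1// => B Bz.
  have [|w [[Dw _] Bw]] := clz (D `&` ~` W) B _ Bz; first by exists D.
  by exists w.
have [|w [[_ nWw] Ww]] := clz (setT `&` ~` W) W _ (open_nbhs_nbhs (conj oW Wz)).
  by exists setT => //; split=> //; exact: clopenT.
exact: nWw.
Qed.

(* In a compact Hausdorff space quasicomponents are connected. *)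
Lemma compact_totally_disconnected_zero_dimensional (T : topologicalType) :
  compact [set: T] -> hausdorff_space T -> totally_disconnected [set: T] ->
  zero_dimensional T.
Proof.
move=> cT hT dT x y /eqP xy; apply: contrapT => nsep; apply: xy.
pose Q := [set z : T | forall D, clopen D -> D x -> D z].
have Qx : Q x by [].
have Qy : Q y.
  move=> D cD Dx; apply: contrapT => nDy; apply: nsep.
  by exists D.
have clQ : closed Q.
  have -> : Q = \bigcap_(D in [set D | clopen D /\ D x]) D.
    apply/seteqP; split=> [z Qz D [cD Dx]|z Qz D cD Dx]; first exact: Qz.
    exact: Qz.
  by apply: closed_bigI => D [[_ cD] _].
(* Let the quasicomponent [Q] of [x] split into disjoint closed [P] and [P'], with [x] in [P].
   Normality separates them by open [U] and [V], and some clopen [D] around [x] lies in their union.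
   Then [D] meets [U] in a clopen set around [x], which contains [Q] and misses [P']. *)
have half P P' : closed P -> closed P' -> P `&` P' = set0 ->
    Q `<=` P `|` P' -> P x -> P' `<=` Q -> P' = set0.
  move=> clP clP' PP' QPP' Px P'Q.
  have [|U' /set_nbhsP[U [oU PU UU']] U'P'] :=
      compact_normal hT cT clP (_ : set_nbhs P (~` P')).
    apply/set_nbhsP; exists (~` P'); split=> //; first exact: closed_openC.
    exact/disjoints_subset.
  pose V := ~` closure U'.
  have oV : open V by exact/closed_openC/closed_closure.
  have P'V : P' `<=` V by move=> z P'z /U'P'.
  have UV0 z : U z -> V z -> False.
    by move=> Uz; apply; apply: subset_closure; exact: UU'.
  have [|z Qz|D [[oD cD] Dx DUV]] := @compact_clopen_sub T x (U `|` V) cT.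
  - exact: openU.
  - by have [/PU|/P'V] := QPP' _ Qz; [left|right].
  rewrite -subset0 => z P'z.
  have [] : (D `&` U) z.
    apply: (P'Q _ P'z); last by split=> //; exact: PU.
    split; first exact: openI.
    have -> : D `&` U = D `&` ~` V.
      apply/seteqP; split=> w [Dw].
        by move=> Uw; split=> // Vw; exact: UV0 Uw Vw.
      by move=> nVw; split=> //; have [|/nVw] := DUV _ Dw.
    by apply: closedI => //; exact: open_closedC.
  by move=> _ Uz; apply: UV0 Uz (P'V _ P'z).
suff connQ : connected Q.
  have : connected_component [set: T] x y by exists Q.
  by rewrite dT// => ->.
move=> B B0 [C oC BC] [D cD BD].
have clB : closed B by rewrite BD; exact: closedI.
have clB' : closed (Q `&` ~` C) by apply: closedI => //; exact: open_closedC.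
have BB' : B `&` (Q `&` ~` C) = set0.
  by rewrite -subset0 => z [+ [_ nCz]]; rewrite BC => -[_ /nCz].
have QBB' z : Q z -> B z \/ (Q `&` ~` C) z.
  by move=> Qz; have [Cz|nCz] := pselect (C z); [left; rewrite BC|right].
have BQ : B `<=` Q by rewrite BC => z [].
have [Bx|B'x] := QBB' _ Qx.
  have B'0 := half _ _ clB clB' BB' QBB' Bx (@subIsetl _ Q (~` C)).
  apply/seteqP; split=> // z Qz; have [//|] := QBB' _ Qz.
  by rewrite B'0.
have : B = set0.
  apply: (half _ _ clB' clB) => //; first by rewrite setIC.
  by move=> z /QBB'[]; [right|left].
by have [b Bb] := B0 => B00; move: Bb; rewrite B00.
Qed.

(** * Metrizability from countably many clopen sets *)

Section separation_metric.
Context {R : realType} {T : Type} (U : nat -> set T).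

(** As [n.+1%:R^-1] decreases, the supremum is attained at the first [U n] separating the points: a
    Cantor space distance between their membership sequences. *)
Let gaps x y : set R := [set n.+1%:R^-1 | n in [set n | U n x <> U n y]].

(* When no [U n] separates [x] and [y], this is [sup set0 = 0]. *)
Definition separation_metric x y : R := sup (gaps x y).

Let gaps_ub x y n : U n x <> U n y -> n.+1%:R^-1 <= separation_metric x y.
Proof.
move=> Uxy; apply: ub_le_sup; last by exists n.
by exists 1 => _ [m _ <-]; rewrite invf_le1// ler1n.
Qed.

Let gaps_le x y (b : R) : 0 <= b ->
  (forall n, U n x <> U n y -> n.+1%:R^-1 <= b) -> separation_metric x y <= b.
Proof.
move=> b0 ub; rewrite /separation_metric.
have [g0|/nonemptyPn ->] := pselect (gaps x y !=set0); last by rewrite sup0.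
by apply: ge_sup => // _ [n Un <-]; exact: ub.
Qed.

Lemma separation_metric_ge0 x y : 0 <= separation_metric x y.
Proof.
have [[n Un]|nU] := pselect (exists n, U n x <> U n y).
  by apply: le_trans (gaps_ub Un); rewrite invr_ge0.
rewrite /separation_metric (_ : gaps x y = set0) ?sup0//.
by rewrite -subset0 => r [n Un _]; apply: nU; exists n.
Qed.

Lemma separation_metric_sym x y : separation_metric x y = separation_metric y x.
Proof.
congr sup; apply/seteqP.
by split=> _ [n Un <-]; exists n => //; exact: nesym.
Qed.

Lemma separation_metric_triangle x y z :
  separation_metric x z <= separation_metric x y + separation_metric y z.
Proof.
apply: gaps_le => [|n Un]; first by rewrite addr_ge0// separation_metric_ge0.
(* A set separating [x] from [z] separates [x] from [y] or [y] from [z]. *)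
have [Uxy|/gaps_ub le] := pselect (U n x = U n y).
  have /gaps_ub le : U n y <> U n z by rewrite -Uxy.
  by rewrite (le_trans le)// lerDr separation_metric_ge0.
by rewrite (le_trans le)// lerDl separation_metric_ge0.
Qed.

Lemma separation_metric_lt n x y :
  separation_metric x y < n.+1%:R^-1 -> U n x = U n y.
Proof. by apply: contraPP => /gaps_ub; rewrite leNgt => /negP. Qed.

Lemma separation_metric_le n x y :
  (forall m, (m < n)%N -> U m x = U m y) -> separation_metric x y <= n.+1%:R^-1.
Proof.
move=> agree; apply: gaps_le => // m Um.
rewrite lef_pV2 ?posrE// ler_nat ltnS leqNgt.
by apply/negP => /agree.
Qed.

End separation_metric.

(** [U] enumerates the clopen sets, which separate points and form a base since the space is
    zero-dimensional. The ball of radius [n.+1%:R^-1] around a point of [U n] stays in [U n]. *)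
Lemma metrizable_of_countable_clopen (R : realType) (T : topologicalType) :
  compact [set: T] -> hausdorff_space T -> totally_disconnected [set: T] ->
  countable (@clopen T) -> metrizable R T.
Proof.
move=> cT hT dT cC.
have zT := compact_totally_disconnected_zero_dimensional cT hT dT.
have [f fC] := countable_enum set0 cC.
have /choice[U UP] (n : nat) : exists V, clopen V /\ (clopen (f n) -> V = f n).
  have [cf|ncf] := pselect (clopen (f n)); first by exists (f n).
  by exists set0; split=> //; exact: clopen0.
have UE D : clopen D -> exists n, U n = D.
  move=> cD; have [n _ fn] := fC _ cD; exists n.
  by rewrite (UP n).2 fn.
exists (separation_metric U); split.
- move=> x y; split=> [d0|->].
    apply: contrapT => /eqP /zT[D [/UE[n Un] Dx nDy]]; apply: nDy.
    by rewrite -Un -(@separation_metric_lt R _ U n x) ?d0 ?invr_gt0// Un.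
  apply/eqP; rewrite eq_le separation_metric_ge0 andbT.
  rewrite /separation_metric (_ : [set _ | _ in _] = set0) ?sup0//.
  by rewrite -subset0 => r [].
- exact: separation_metric_sym.
- exact: separation_metric_triangle.
- move=> W; split=> [oW x Wx|ballW].
    have [D [Dx /UE[n Un]] DW] :=
      zero_dimensional_cvg hT zT cT (open_nbhs_nbhs (conj oW Wx)).
    exists n.+1%:R^-1; first by rewrite invr_gt0.
    move=> y dxy; have Uxy := separation_metric_lt dxy.
    by apply: DW; rewrite -Un -Uxy Un.
rewrite openE => x /ballW[e e0 eW].
have [n ne] : exists n : nat, n.+1%:R^-1 < e.
  by have [n] := ltr_add_invr e0; rewrite add0r; exists n.
(* Membership in a clopen [U m] is locally constant, and indices from [n] on contribute at most
   [n.+1%:R^-1]. *)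
have : \forall y \near x, forall m, (m < n)%N -> U m x = U m y.
  elim: n {ne} => [|n IHn]; first exact: nearW.
  have Un : \forall y \near x, U n x = U n y.
    have [oU cU] := (UP n).1.
    have [Ux|nUx] := pselect (U n x).
      apply: filterS (open_nbhs_nbhs (conj oU Ux)) => y Uy.
      exact/propext.
    apply: filterS (open_nbhs_nbhs (conj (closed_openC cU) nUx)) => y nUy.
    exact/propext.
  apply: filterS2 IHn Un => y IH Uy m.
  by rewrite ltnS leq_eqVlt => /predU1P[->//|]; exact: IH.
apply: filterS => y Uy; apply: eW.
exact: le_lt_trans (separation_metric_le Uy) ne.
Qed.
Import HBSimple.

(** * Separability of L1 from a countable dense family of measurable sets *)

Section step_functions.
Context d (T : measurableType d) (R : realType) (mu : probability T R).
Context (g : nat -> set T) (mg : forall n, measurable (g n)).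

(** Rational combinations of indicators of the [g n], coded by finite lists, which form a countable
    type. *)
Let step (s : seq (rat * nat)) (x : T) : R :=
  \sum_(p <- s) ratr p.1 * \1_(g p.2) x.

Let step_approx (f : T -> R) := forall e : R, 0 < e ->
  exists s, (\int[mu]_x `|f x - step s x|%:E < e%:E)%E.

Let measurable_step s : measurable_fun [set: T] (step s).
Proof.
apply: measurable_sum => p; apply: measurable_funM => //.
Qed.

Let measurable_dist (f h : T -> R) :
  measurable_fun [set: T] f -> measurable_fun [set: T] h ->
  measurable_fun [set: T] (fun x => `|f x - h x|%:E).
Proof.
move=> mf mh; apply/measurable_EFinP; apply: measurableT_comp => //.
exact: measurable_funB.
Qed.

Let L1_dist_triangle (f h k : T -> R) :
  measurable_fun [set: T] f -> measurable_fun [set: T] h ->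
  measurable_fun [set: T] k ->
  (\int[mu]_x `|f x - k x|%:E <=
   \int[mu]_x `|f x - h x|%:E + \int[mu]_x `|h x - k x|%:E)%E.
Proof.
move=> mf mh mk; rewrite -ge0_integralD//=; do ?exact: measurable_dist.
apply: ge0_le_integral => //.
- exact: measurable_dist.
- by apply: emeasurable_funD; exact: measurable_dist.
- by move=> x _; rewrite -EFinD lee_fin ler_distD.
Qed.

Let step_approxD (f h : T -> R) :
  measurable_fun [set: T] f -> measurable_fun [set: T] h ->
  step_approx f -> step_approx h -> step_approx (fun x => f x + h x).
Proof.
move=> mf mh af ah e e0.
have e20 : 0 < e / 2 by rewrite divr_gt0.
have [[s sf] [t th]] := (af _ e20, ah _ e20).
exists (s ++ t); apply: (@le_lt_trans _ _
    (\int[mu]_x `|f x - step s x|%:E + \int[mu]_x `|h x - step t x|%:E)%E).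
  rewrite -ge0_integralD//=; do ?exact: measurable_dist.
  apply: ge0_le_integral => //.
  - by apply: measurable_dist => //; exact: measurable_funD.
  - by apply: emeasurable_funD; exact: measurable_dist.
  - move=> x _; rewrite -EFinD lee_fin /step big_cat/= opprD addrACA.
    exact: ler_normD.
by rewrite [e in ltRHS](splitr e) EFinD lteD.
Qed.

Context (g_dense : forall E (e : R), measurable E -> 0 < e ->
  exists n, (mu ((E `\` g n) `|` (g n `\` E)) < e%:E)%E).

Let step_approx_indic (c : R) (E : set T) :
  measurable E -> step_approx (fun x => c * \1_E x).
Proof.
move=> mE e e0.
have /rat_in_itvoo[q] : c - e / 2 < c + e / 2 by lra.
rewrite in_itv/= => /andP[q1 q2].
have cq : `|c - ratr q| < e / 2 by rewrite ltr_norml; apply/andP; split; lra.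
set b : R := `|ratr q|.
have b0 : 0 <= b by exact: normr_ge0.
(* Dividing by [b + 1] keeps the bound meaningful when [b] is 0, and still gives [b] times the mass
   at most [e / 2]. *)
have [|n En] := @g_dense E (e / 2 / (b + 1)) mE.
  by rewrite !divr_gt0// ltr_wpDl.
exists [:: (q, n)]; set D := (E `\` g n) `|` (g n `\` E) in En.
have mD : measurable D by apply: measurableU; exact: measurableD.
(* The error is at most [|c - ratr q|] everywhere, plus [b] on the symmetric difference [D]. *)
apply: (@le_lt_trans _ _
    (\int[mu]_x (`|c - ratr q|%:E + b%:E * (\1_D x)%:E))%E).
  apply: ge0_le_integral => //.
  - by apply: measurable_dist => //; exact: measurable_funM.
  - apply: emeasurable_funD => //; apply: emeasurable_funM => //.
    by apply/measurable_EFinP; exact: measurable_indic.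
  - move=> x _; rewrite /step big_seq1/= -EFinM -EFinD lee_fin !indicE.
    rewrite in_setU !in_setD.
    case: (x \in E) (x \in g n) => -[] /=;
      rewrite ?mulr1 ?mulr0 ?addr0 ?subr0//.
    + have -> : c = (c - ratr q) + ratr q by rewrite subrK.
      by rewrite (le_trans (ler_normD _ _))// subrK.
    + by rewrite sub0r normrN lerDr.
    + by rewrite normr0.
rewrite ge0_integralD//=; last 2 first.
- by move=> x _; rewrite mule_ge0// lee_fin.
- apply: emeasurable_funM => //.
  by apply/measurable_EFinP; exact: measurable_indic.
rewrite integral_cst// [X in (_ * X + _)%E](_ : _ = 1%E); last first.
  exact: probability_setT.
rewrite mule1 ge0_integralZl//=; last first.
  by apply/measurable_EFinP; exact: measurable_indic.
rewrite integral_indic// setIT [e in ltRHS](splitr e) EFinD.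
apply: lte_leD; rewrite ?lte_fin//.
  by rewrite fin_numM// fin_num_measure.
apply: (@le_trans _ _ (b%:E * (e / 2 / (b + 1))%:E)%E).
  by rewrite lee_wpmul2l// ltW.
rewrite -EFinM lee_fin mulrA ler_pdivrMr ?ltr_wpDl//.
by rewrite mulrC ler_wpM2l ?lerDl// divr_ge0// ltW.
Qed.

(** A simple function is a finite sum of multiples of indicators of its fibres. *)
Let step_approx_sfun (f : {sfun T >-> R}) : step_approx f.
Proof.
pose h y x : R := y * \1_(f @^-1` [set y]) x.
have mh y : measurable_fun [set: T] (h y) by exact: measurable_funM.
have -> : (f : T -> R) = (fun x =>
    \sum_(y <- finmap.enum_fset (fset_set (range f))) h y x).
  by apply/funext => x; rewrite fimfunE fsbig_finite.
elim: (finmap.enum_fset _) => [|y t IHt].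
  move=> e e0; exists [::]; rewrite integral0_eq ?lte_fin// => x _.
  by rewrite big_nil /step big_nil subrr normr0.
under eq_fun do rewrite big_cons.
apply: step_approxD => //; first exact: measurable_sum.
exact: step_approx_indic.
Qed.

Lemma L1_separable_of_dense : L1_separable mu.
Proof.
have Lmeas (f : LspaceType1 mu) : measurable_fun [set: T] (f : T -> R).
  exact: (@measurable_funPT _ _ _ _ (repr (LebesgueSpace.sort f))).
have Lint (f : LspaceType1 mu) : mu.-integrable [set: T] (EFin \o f).
  apply/Lfun1_integrable; rewrite inE; apply/andP; split; rewrite inE/=.
    exact: Lmeas.
  exact: Lebesgue_finite.
have Lapprox (f : LspaceType1 mu) : step_approx f.
  move=> e e0.
  have [h [_ _ hf]] := approximation_sfun_integrable measurableT (Lint f).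
  have e20 : 0 < e / 2 by rewrite divr_gt0.
  have [n hn] : exists n, (\int[mu]_x `|f x - h n x|%:E < (e / 2)%:E)%E.
    have /fine_cvgP[hfin /cvgr0Pnorm_lt/(_ _ e20) hlt] := hf.
    have [n [/= hn_fin hn]] := filter_ex (filterI hfin hlt).
    exists n; rewrite -(fineK hn_fin) lte_fin.
    exact: le_lt_trans (ler_norm _) hn.
  have [s hs] := step_approx_sfun (h n) e20.
  exists s; rewrite [e in ltRHS](splitr e) EFinD.
  apply: le_lt_trans (lteD hn hs).
  exact: L1_dist_triangle.
have [[f0 _]|/nonemptyPn L0] := pselect ([set: LspaceType1 mu] !=set0);
  last first.
  exists set0 => // f; have : [set: LspaceType1 mu] f by [].
  by rewrite L0.
(* The countable dense set consists of L1 classes chosen near step functions: [G (s, n)] is within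
   [n.+1%:R^-1] of [step s] if some class is, and unconstrained otherwise. *)
pose close (p : seq (rat * nat) * nat) (f : LspaceType1 mu) :=
  (\int[mu]_x `|f x - step p.1 x|%:E < (p.2.+1%:R^-1)%:E)%E.
have /choice[G GP] p : exists f, (exists f, close p f) -> close p f.
  have [[f pf]|npf] := pselect (exists f, close p f); first by exists f.
  by exists f0.
exists (range G); first exact/countable_image/countableP.
move=> f e e0; have e20 : 0 < e / 2 by rewrite divr_gt0.
have [n] := ltr_add_invr e20; rewrite add0r => ne.
have [|s fs] := Lapprox f n.+1%:R^-1; first by rewrite invr_gt0.
exists (G (s, n)); first by exists (s, n).
have Gs : close (s, n) (G (s, n)) by apply: GP; exists f.
rewrite Lnorm1; apply: (@le_lt_trans _ _ (\int[mu]_x `|f x - step s x|%:E +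
    \int[mu]_x `|step s x - G (s, n) x|%:E)%E).
  exact: L1_dist_triangle.
rewrite [e in ltRHS](splitr e) EFinD lteD//; first by rewrite (lt_trans fs).
under eq_integral do rewrite distrC.
exact: lt_trans Gs _.
Qed.
End step_functions.

(** * Radon measures of uncountable type *)

(** Compact sets approximating [E] from inside are closed, hence Borel; as [mu] is finite, closeness
    of masses bounds the mass of the difference. *)
Lemma radon_inner_closed (R : realType) (K : topologicalType) (x0 : K)
    (mu : probability (borel x0) R) (E : set (borel x0)) (e : R) :
  hausdorff_space K -> radon mu -> measurable E -> 0 < e ->
  exists C : set K, [/\ closed C, C `<=` E, measurable (C : set (borel x0)) &
    (mu (E `\` C) < e%:E)%E].
Proof.
move=> hK rmu mE e0.
have mufin (A : set (borel x0)) : measurable A -> mu A \is a fin_num.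
  by move=> mA; exact: fin_num_measure.
have := @ub_ereal_sup_adherent _
  [set mu C | C in [set C : set K | compact C /\ C `<=` E]] e e0.
rewrite -rmu// => /(_ (mufin _ mE))[_ [C [cC CE] <-] EC].
have clC : closed C := compact_closed hK cC.
have mC : measurable (C : set (borel x0)).
  rewrite -[C]setCK; apply: measurableC; apply: sub_sigma_algebra.
  exact: closed_openC.
exists C; split=> //; rewrite measureD//; last first.
  by rewrite ltey_eq mufin.
by rewrite setIidr// lteBlDr ?mufin// -lteBlDl ?mufin.
Qed.

Lemma linked_of_radon (R : realType) (K : topologicalType) :
  hausdorff_space K -> has_radon_uncountable_type R K ->
  has_uncountable_linked_closed K.
Proof.
move=> hK [x0 [mu [rmu nsep]]].
pose sd (E F : set (borel x0)) := (E `\` F) `|` (F `\` E).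
have msd E F : measurable E -> measurable F -> measurable (sd E F).
  by move=> mE mF; apply: measurableU; exact: measurableD.
have /choice[Y YP] (n : nat) := @maximal_separated _
  (@measurable _ (borel x0)) (fun E F => (mu (sd E F) < (n.+1%:R^-1)%:E)%E)
  (fun E => ltac:(by rewrite /sd setDv setU0 measure0 lte_fin))
  (fun E F => ltac:(by rewrite /sd setUC)).
(* If every [Y n] were countable, their union would be dense for the distance [mu (sd E F)], making
   L1 separable. *)
have [n Yn] : exists n, ~ countable (Y n).
  apply: contrapT => /forallNP cY; apply: nsep.
  have cD : countable (\bigcup_n Y n).
    apply: bigcup_countable => [|n _]; first exact: countableP.
    exact: contrapT (cY n).
  have [f fD] := countable_enum set0 cD.
  have /choice[g gP] (n : nat) : exists E : set (borel x0),
      measurable E /\ (measurable (f n) -> E = f n).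
    by have [mf|nmf] := pselect (measurable (f n)); [exists (f n)|exists set0].
  apply: (@L1_separable_of_dense _ _ _ mu g) => [n|E e mE e0].
    by have [] := gP n.
  have [n] := ltr_add_invr e0; rewrite add0r => ne.
  have [YS _ /(_ _ mE)[F YF EF]] := YP n.
  have [|m _ fm] := fD F; first by exists n.
  exists m; rewrite (gP m).2; last by rewrite fm; exact: YS.
  by rewrite fm; apply: lt_trans EF _; rewrite lte_fin.
have [YS Ysep _] := YP n.
pose e : R := n.+1%:R^-1 / 2 / 2.
have e0 : 0 < e by rewrite !divr_gt0// invr_gt0.
have /choice[A AP] (E : set (borel x0)) : exists A : set K, measurable E ->
    [/\ closed A, A `<=` E, measurable (A : set (borel x0)) &
      (mu (E `\` A) < e%:E)%E].
  have [mE|nmE] := pselect (measurable E); last by exists set0.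
  by have [A AP] := radon_inner_closed hK rmu mE e0; exists A.
apply: (@linked_of_uncountable _ K (Y n) A (fun E => A (~` E))) => //.
- move=> E /YS mE; have [clA AE _ _] := AP E mE.
  have [clB BE _ _] := AP _ (measurableC mE); split=> //.
  by rewrite -subset0 => x [/AE Ex /BE].
move=> E F YE YF EF; have [mE mF] := (YS _ YE, YS _ YF).
have [_ _ mAE lE] := AP E mE; have [_ _ mAF lF] := AP F mF.
have [_ _ mBE lE'] := AP _ (measurableC mE).
have [_ _ mBF lF'] := AP _ (measurableC mF).
apply: contrapT => /not_orP[EF0 FE0]; apply: (Ysep _ _ YE YF EF).
pose N := ((E `\` A E) `|` (~` F `\` A (~` F))) `|`
          ((F `\` A F) `|` (~` E `\` A (~` E))).
have mD P Q : measurable P -> measurable (Q : set (borel x0)) ->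
  measurable (P `\` Q : set (borel x0)) by exact: measurableD.
have [mE' mF'] := (measurableC mE, measurableC mF).
apply: (@le_lt_trans _ _ (mu N)).
  apply: le_measure; rewrite ?inE.
  - exact: msd.
  - by apply: measurableU; apply: measurableU; exact: mD.
  move=> x [[Ex nFx]|[Fx nEx]]; [left|right].
    have [Ax|nAx] := pselect (A E x); last by left.
    by right; split=> // Bx; apply: EF0; exists x.
  have [Ax|nAx] := pselect (A F x); last by left.
  by right; split=> // Bx; apply: FE0; exists x.
apply: (@le_lt_trans _ _ ((mu (E `\` A E) + mu (~` F `\` A (~` F))) +
    (mu (F `\` A F) + mu (~` E `\` A (~` E))))%E).
  apply: (le_trans (measureU2 _ _ _)); try by apply: measurableU; exact: mD.
  by apply: leeD; apply: measureU2; exact: mD.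
have -> : n.+1%:R^-1 = (e + e) + (e + e) :> R by rewrite -!splitr.
by rewrite !EFinD; do !apply: lteD.
Qed.

Theorem theorem2 (R : realType) (K : topologicalType) :
  compact [set: K] -> hausdorff_space K ->
  ((exists Omega : set K,
      [/\ closed Omega, ~ metrizable R (set_type Omega) &
          totally_disconnected Omega]) ->
   exists Omega : set K,
     closed Omega /\ ~ countable (@clopen (set_type Omega))) /\
  ((exists Omega : set K,
      closed Omega /\ ~ countable (@clopen (set_type Omega))) \/
   ~ hereditarily lindelof K \/
   ~ hereditarily separable K \/
   ([set: nat -> bool] #<= [set: K] /\ [set: K] #!= [set: nat -> bool]) \/
   has_radon_uncountable_type R K ->
   has_uncountable_linked_closed K /\
   exists S : set (continuousType K R),
     [/\ S `<=` unit_ball R K, equilateral (@sup_dist R K) 2 S &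
         ~ countable S]).
Proof.
move=> cK hK; split.
  (* With only countably many clopen sets, the subspace would be metrizable. *)
  move=> [W [clW nmet tdW]]; exists W; split=> // cC; apply: nmet.
  apply: metrizable_of_countable_clopen => //.
  - exact/compact_subtype/subclosed_compact/subsetT.
  - exact: hausdorff_subtype.
  - exact: totally_disconnected_subtype.
move=> conds; have link : has_uncountable_linked_closed K.
  case: conds => [[W [clW unc]]|[nL|[nS|[[leK neK]|rad]]]].
  - exact: linked_of_clopen clW unc.
  - exact: linked_of_not_lindelof.
  - exact: linked_of_not_separable.
  - exact: linked_of_large.
  - exact: linked_of_radon rad.
by split=> //; exact: equilateral_of_linked.
Qed.
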